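(* Let $\phi\colon\mathbb{R}\times\Lambda\to\Lambda$ be a continuous flow of a compact metric space $(\Lambda,\operatorname{dist})$. Then $\phi$ is KH-expansive if and only if $\phi$ is separating and $\operatorname{fix}(\phi)$ is an open subset of $\Lambda$.
   Context: $\operatorname{fix}(\phi)=\{\sigma\in\Lambda:\phi_t(\sigma)=\sigma\text{ for all }t\in\mathbb{R}\}$, and $\phi_{\mathbb{R}}(x)$ is the orbit of $x$. $\phi$ is separating if there is $\delta>0$ such that if $x,y\in\Lambda$ and $\operatorname{dist}(\phi_t(x),\phi_t(y))<\delta$ for all $t\in\mathbb{R}$, then $y\in\phi_{\mathbb{R}}(x)$. $\phi$ is KH-expansive (expansive in the sense of Katok–Hasselblatt) if there is $\delta>0$ such that: if $x\in\Lambda$, $s\colon\mathbb{R}\to\mathbb{R}$ is continuous with $s(0)=0$ and $\operatorname{dist}(\phi_t(x),\phi_{s(t)}(x))<\delta$ for all $t\in\mathbb{R}$, and $y\in\Lambda$ is such that $\operatorname{dist}(\phi_t(x),\phi_{s(t)}(y))<\delta$ for all $t\in\mathbb{R}$, then $y\in\phi_{\mathbb{R}}(x)$. *)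

(* Defs.v *)
From HB Require Import structures.
From mathcomp Require Import all_boot all_order all_algebra.
From mathcomp Require Import all_classical all_reals all_analysis.

Set Implicit Arguments.
Unset Strict Implicit.
Unset Printing Implicit Defensive.

Import Order.TTheory GRing.Theory Num.Theory.
Import numFieldNormedType.Exports.

Local Open Scope classical_set_scope.
Local Open Scope ring_scope.

Record continuous_flow (R : realType) (L : topologicalType) (phi : R -> L -> L)
    : Prop := ContinuousFlow {
  flow0 : forall x, phi 0 x = x;
  flowD : forall s t x, phi (s + t) x = phi s (phi t x);
  flow_continuous : continuous (fun p : R * L => phi p.1 p.2)
}.

Definition flow_orbit (R : realType) (L : Type) (phi : R -> L -> L) (x : L)
  : set L := range (phi ^~ x).

Definition flow_fix (R : realType) (L : Type) (phi : R -> L -> L) : set L :=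
  [set x | forall t : R, phi t x = x].

Definition separating (R : realType) (L : metricType R) (phi : R -> L -> L)
    : Prop :=
  exists delta : R, 0 < delta /\
    forall x y : L,
      (forall t : R, mdist (phi t x) (phi t y) < delta) ->
      flow_orbit phi x y.

(* Expansivity in the sense of Katok-Hasselblatt; the reparametrization [s] is
   not required to be monotone or surjective. *)
Definition KH_expansive (R : realType) (L : metricType R) (phi : R -> L -> L)
    : Prop :=
  exists delta : R, 0 < delta /\
    forall (x : L) (s : R -> R),
      continuous s -> s 0 = 0 ->
      (forall t : R, mdist (phi t x) (phi (s t) x) < delta) ->
      forall y : L,
        (forall t : R, mdist (phi t x) (phi (s t) y) < delta) ->
        flow_orbit phi x y.

(* Main.v *)
(** A fixed point x has a singleton orbit, so KH-expansivity applied to x with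
    the constant reparametrization s = 0 isolates x.

    Conversely, assume that the fixed points form an open set.  Periods of the
    other points cannot be arbitrarily small near any point, hence by compactness
    there are T, g > 0 such that dist(phi_T(z), z) >= g at every nonfixed z.  If
    dist(phi_t(x), phi_{s(t)}(x)) < g for all t, with x not fixed, then s(t) - t
    never takes the values T and -T; it vanishes at 0, so it stays in ]-T, T[
    and s is onto.  Closeness of phi_{s(t)}(x) and phi_{s(t)}(y) for all t is
    then closeness along whole orbits, and separation applies. *)
Require Import Defs.
From mathcomp Require Import all_boot all_order all_algebra.
From mathcomp Require Import all_classical all_reals all_analysis.
From mathcomp Require Import lra.

Import Order.TTheory GRing.Theory Num.Theory.
Import numFieldNormedType.Exports.

Local Open Scope classical_set_scope.
Local Open Scope ring_scope.

(** The near-covering form of compactness, for the filter of right neighbourhoods of 0. Asking for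
    [P e y] at all small [e] lets finitely many local radii share one [e]. *)
Lemma compact_uniform_radius (R : realType) (L : metricType R)
    (P : R -> L -> Prop) :
  compact [set: L] ->
  (forall x, exists2 r, 0 < r &
     forall e y, 0 < e < r -> mdist x y < r -> P e y) ->
  exists2 e, 0 < e & forall x, P e x.
Proof.
move=> /compact_near_coveringP cptL locP.
have nearP : \forall e \near 0^'+, [set: L] `<=` P e.
  apply: (cptL R (0^'+) P) => x _.
  have [r r0 rP] := locP x.
  exists ([set y | mdist x y < r], [set e | 0 < e < r]) => /=.
    split; first by rewrite -ballEmdist; exact: nbhsx_ballx.
    near=> e; rewrite /=; apply/andP; split; near: e.
      exact: nbhs_right_gt.
    exact: nbhs_right_lt.
  by move=> [y e] /= [xy er]; exact: rP.
have [e [e0 eP]] : exists e : R, 0 < e /\ [set: L] `<=` P e.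
  apply: (@filter_ex _ (0^'+ : set_system R)).
  by near=> e; split; near: e => //; exact: nbhs_right_gt.
by exists e => // x; exact: eP.
Unshelve. all: by end_near. Qed.

Section real_functions.
Context {R : realType}.

Lemma continuous_IVT (f : R -> R) (a b v : R) :
  continuous f -> f a <= v <= f b -> exists c, f c = v.
Proof.
move=> cf fab; have [ab|/ltW ba] := leP a b.
  have [||c _ <-] := @IVT R f a b v ab; last by exists c.
    exact: continuous_subspaceT.
  by rewrite ge_min le_max; case/andP: fab => -> ->; rewrite orbT.
have [||c _ <-] := @IVT R f b a v ba; last by exists c.
  exact: continuous_subspaceT.
by rewrite ge_min le_max; case/andP: fab => -> ->; rewrite orbT.
Qed.

(** At [v - T] the value of [s] is at most [v], at [v + T] at least [v]. *)
Lemma surjective_near_id (s : R -> R) (T : R) :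
  continuous s -> (forall t, `|s t - t| <= T) -> forall v, exists t, s t = v.
Proof.
move=> cs sT v; apply: (@continuous_IVT s (v - T) (v + T)) => //.
have := sT (v - T); have := sT (v + T); rewrite !ler_norml; lra.
Qed.

Lemma norm_lt_avoid (h : R -> R) (T : R) :
  continuous h -> h 0 = 0 -> 0 < T -> (forall t, `|h t| != T) ->
  forall t, `|h t| < T.
Proof.
move=> ch h0 T0 hT t; rewrite ltNge; apply/negP => Tt.
have [||c hc] := @continuous_IVT (fun u => `|h u|) 0 t T.
- by move=> u; apply: continuous_comp; [exact: ch|exact: norm_continuous].
- by rewrite h0 normr0 (ltW T0).
- by move: (hT c); rewrite hc eqxx.
Qed.

End real_functions.

Section flows.
Context {R : realType} {L : metricType R} {phi : R -> L -> L}.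
Hypothesis flow_phi : continuous_flow phi.

Lemma flow_local_continuity (t : R) (x : L) (e : R) : 0 < e ->
  exists2 r, 0 < r & forall u y, `|t - u| < r -> mdist x y < r ->
    mdist (phi t x) (phi u y) < e.
Proof.
move=> e0; have /(_ (t, x)) /= ct := flow_continuous flow_phi.
have : nbhs (phi t x) (ball (phi t x) e) by exact: nbhsx_ballx.
move=> /ct /= [[A B] /= [At Bx] AB].
move: At Bx => /nbhs_ballP[/= r1 r10 rA] /nbhs_ballP[/= r2 r20 rB].
exists (Num.min r1 r2); first by rewrite lt_min r10.
move=> u y; rewrite !lt_min => /andP[tu _] /andP[_ xy].
have /AB : (A `*` B) (u, y).
  by split => /=; [exact: rA|apply: rB; rewrite ballEmdist].
by rewrite /= ballEmdist.
Qed.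

Lemma flow_period_natmul (T : R) (x : L) (n : nat) :
  phi T x = x -> phi (T *+ n) x = x.
Proof.
move=> Tx; elim: n => [|n IH]; first by rewrite mulr0n (flow0 flow_phi).
by rewrite mulrS (flowD flow_phi) IH.
Qed.

Lemma flow_period_opp (T : R) (x : L) : phi T x = x -> phi (- T) x = x.
Proof.
by move=> Tx; rewrite -{1}Tx -(flowD flow_phi) addNr (flow0 flow_phi).
Qed.

Lemma flow_period_intmul (T : R) (x : L) (m : int) :
  phi T x = x -> phi (T *~ m) x = x.
Proof.
move=> Tx; case: m => n; first exact: flow_period_natmul.
by rewrite NegzE mulrNz; exact/flow_period_opp/flow_period_natmul.
Qed.

(** Choose [t] with [phi t x] different from [x]. If [y] near [x] had a tiny period, [phi t y] would
    be almost [y], so [phi t x] would be too close to [x]. *)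
Lemma no_small_period_near (x : L) : ~ flow_fix phi x ->
  exists2 r, 0 < r &
    forall T y, 0 < T < r -> mdist x y < r -> phi T y <> y.
Proof.
move=> /existsNP[t /eqP tx].
have d0 : 0 < mdist (phi t x) x by rewrite mdist_gt0.
set d := mdist (phi t x) x in d0.
have [r r0 rP] := flow_local_continuity t x _ (divr_gt0 d0 (ltr0n _ 2)).
exists (Num.min r (d / 2)); first by rewrite lt_min r0/= divr_gt0.
move=> T y /andP[T0]; rewrite !lt_min => /andP[Tr Td] /andP[xyr xyd] Ty.
(* some multiple of the period T is within T of t *)
have tu : `|t - T *~ Num.floor (t / T)| < r.
  apply: le_lt_trans Tr; rewrite -mulrzr.
  have : (Num.floor (t / T))%:~R <= t / T by exact: floor_le.
  have : t / T < (Num.floor (t / T) + 1)%:~R by exact: floorD1_gt.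
  rewrite ltr_pdivrMr // ler_pdivlMr // intrD => h1 h2.
  rewrite ler_norml; lra.
have := rP _ _ tu xyr; rewrite flow_period_intmul // => h1.
have := metric_triangle (phi t x) y x; rewrite -/d (metric_sym y x); lra.
Qed.

Hypothesis cptL : compact [set: L].
Hypothesis open_fix : open (flow_fix phi).

Lemma flow_fix_ball (x : L) : flow_fix phi x ->
  exists2 r, 0 < r & forall y, mdist x y < r -> flow_fix phi y.
Proof.
move: (open_fix); rewrite openE => ofix /ofix/nbhs_ballP[/= r r0 rP].
by exists r => // y xy; apply: rP; rewrite ballEmdist.
Qed.

Lemma fix_uniformly_open :
  exists2 e, 0 < e &
    forall x, flow_fix phi x -> forall y, mdist x y < e -> flow_fix phi y.
Proof.
apply: (@compact_uniform_radius R L (fun e x => flow_fix phi x ->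
  forall y, mdist x y < e -> flow_fix phi y)) => // x.
have [fx|nfx] := pselect (flow_fix phi x).
  have [r r0 rP] := flow_fix_ball x fx.
  exists (r / 2); first by rewrite divr_gt0.
  move=> e y er xy _ z yz; apply: rP.
  have := metric_triangle x y z; lra.
have [r r0 rP] := no_small_period_near x nfx.
exists r => // e y _ xy fy.
(* Every time is a period of a fixed point, so a fixed [y] would have the excluded period [r / 2]:
   the claim is vacuous near [x]. *)
have r2 : 0 < r / 2 < r by lra.
by case: (rP _ _ r2 xy); exact: fy.
Qed.

(** Compactness is used twice: first for a common time [T] that is a period of no nonfixed point,
    then for the bound [g] at that [T]. Near a fixed point both claims are vacuous, as
    [flow_fix phi] is open. *)
Lemma uniform_displacement :
  exists2 T, 0 < T & exists2 g, 0 < g &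
    forall x, ~ flow_fix phi x -> g <= mdist (phi T x) x.
Proof.
have [T T0 noT] : exists2 T, 0 < T &
    forall x, ~ flow_fix phi x -> phi T x <> x.
  apply: (@compact_uniform_radius R L
    (fun T x => ~ flow_fix phi x -> phi T x <> x)) => // x.
  have [fx|nfx] := pselect (flow_fix phi x).
    have [r r0 rP] := flow_fix_ball x fx.
    by exists r => // e y _ /rP.
  have [r r0 rP] := no_small_period_near x nfx.
  by exists r => // T y Tr xy _; exact: rP.
exists T => //.
apply: (@compact_uniform_radius R L
  (fun g x => ~ flow_fix phi x -> g <= mdist (phi T x) x)) => // x.
have [fx|nfx] := pselect (flow_fix phi x).
  have [r r0 rP] := flow_fix_ball x fx.
  by exists r => // e y _ /rP.
have d0 : 0 < mdist (phi T x) x by rewrite mdist_gt0; exact/eqP/noT.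
set d := mdist (phi T x) x in d0.
(* Two errors below [d / 4] leave [y] a displacement above [d / 2], hence above [e]. *)
have [r r0 rP] := flow_local_continuity T x _ (divr_gt0 d0 (ltr0n _ 4)).
exists (Num.min r (d / 4)); first by rewrite lt_min r0/= divr_gt0.
move=> e y /andP[e0]; rewrite !lt_min => /andP[er ed] /andP[xyr xyd] _.
have := rP T y; rewrite subrr normr0 => /(_ r0 xyr).
have := metric_triangle (phi T x) (phi T y) x.
have := metric_triangle (phi T y) y x.
rewrite -/d (metric_sym y x); lra.
Qed.

Lemma reparametrization_surjective :
  exists2 g, 0 < g & forall (x : L) (s : R -> R), ~ flow_fix phi x ->
    continuous s -> s 0 = 0 ->
    (forall t, mdist (phi t x) (phi (s t) x) < g) ->
    forall v, exists t, s t = v.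
Proof.
have [T T0 [g g0 gP]] := uniform_displacement.
exists g => // x s nfx cs s0 sx.
(* The displacement bound is needed at [phi t x] and [phi (s t) x], not at [x]. *)
have nfix t : ~ flow_fix phi (phi t x).
  move=> ft; apply: nfx => u.
  have := ft (- t); rewrite -(flowD flow_phi) addNr (flow0 flow_phi) => xt.
  by rewrite {1}xt ft -xt.
have hT t : `|s t - t| != T.
  apply/eqP => stT; have := sx t.
  have [h0|h0] := leP 0 (s t - t).
    move: stT; rewrite ger0_norm // => stT.
    have -> : s t = T + t by lra.
    by rewrite (flowD flow_phi) metric_sym ltNge gP.
  move: stT; rewrite ltr0_norm // => stT.
  have -> : t = T + s t by lra.
  (* The previous rewrite also replaced the [t] inside [s t]; this undoes it. *)
  have -> : s (T + s t) = s t by congr s; lra.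
  by rewrite (flowD flow_phi) ltNge gP.
apply: (@surjective_near_id R s T) => // t; apply: ltW.
apply: (@norm_lt_avoid R (fun t => s t - t)) => //; last by rewrite s0 subr0.
by move=> u; apply: continuousB; [exact: cs|exact: cvg_id].
Qed.

Lemma separating_KH_expansive : separating phi -> KH_expansive phi.
Proof.
move=> [d [d0 sepd]].
have [e e0 fixe] := fix_uniformly_open.
have [g g0 surjg] := reparametrization_surjective.
(* [e] forces [y] to be fixed when [x] is, [g] makes [s] onto otherwise, and [d / 2] pays for the
   triangle inequality through [phi t x]. *)
exists (Num.min (d / 2) (Num.min e g)); split.
  by rewrite !lt_min e0 g0 divr_gt0.
move=> x s cs s0 sx y sy.
have [fx|nfx] := pselect (flow_fix phi x); apply: sepd => v.
  have := sy 0; rewrite s0 !(flow0 flow_phi) !lt_min => /and3P[xyd xye _].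
  have fy := fixe x fx y xye.
  by rewrite fx fy; lra.
have [|t <-] := surjg x s nfx cs s0 _ v.
  by move=> t; move: (sx t); rewrite !lt_min => /and3P[].
have := sx t; have := sy t.
rewrite !lt_min (metric_sym (phi t x) (phi (s t) x)).
move=> /and3P[h1 _ _] /and3P[h2 _ _].
have := metric_triangle (phi (s t) x) (phi t x) (phi (s t) y); lra.
Qed.

End flows.

(** With [s] the identity, the condition on [x] is trivial and the one on [y] is the separation
    hypothesis. *)
Lemma KH_expansive_separating (R : realType) (L : metricType R)
  (phi : R -> L -> L) : KH_expansive phi -> separating phi.
Proof.
move=> [d [d0 KH]]; exists d; split => // x y xy.
apply: (KH x idfun) => // [t|t]; first exact: cvg_id.
by rewrite mdistxx.
Qed.

Lemma KH_expansive_open_fix (R : realType) (L : metricType R)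
  (phi : R -> L -> L) :
  continuous_flow phi -> KH_expansive phi -> open (flow_fix phi).
Proof.
move=> flow_phi [d [d0 KH]]; rewrite openE => x fx.
apply/nbhs_ballP; exists d => //= y; rewrite ballEmdist /= => xy.
have c0 : continuous (fun _ : R => 0 : R) by move=> t; exact: cvg_cst.
(* As [x] is fixed, the two conditions reduce to [mdist x x < d] and [mdist x y < d]. *)
have [|t|t _ <-] := KH x (fun=> 0) c0 erefl _ y.
- by move=> t; rewrite fx (flow0 flow_phi) mdistxx.
- by rewrite fx (flow0 flow_phi).
- by rewrite fx.
Qed.

Theorem theorem2p9 (R : realType) (L : metricType R) (phi : R -> L -> L)
  (cptL : compact [set: L]) (flow_phi : continuous_flow phi) :
  KH_expansive phi <-> separating phi /\ open (flow_fix phi).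
Proof.
split=> [KH|[sep open_fix]].
  by split; [exact: KH_expansive_separating|exact: KH_expansive_open_fix].
exact: separating_KH_expansive.
Qed.
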